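(* Let $p$ be a prime and let $G$ be a metabelian $p$-group of coclass $1$ and order $p^m$, of nilpotency class $c=m-1\ge2$ (so $m\ge3$), which is isomorphic to the representative $G_a^m(z,w)$ with integer parameters $0\le a(m-1),\ldots,a(m-k),w,z\le p-1$, where $k$ is the defect of commutativity of $G$. Let $\mathfrak{A}=\mathfrak{A}(G)\unlhd\mathbb{Z}[X,Y]$ be the annihilator of $G$ with respect to the normalized generators $x,y$ satisfying the relations of this representative. Then the commutator subgroup $G'$ is isomorphic to the nearly homocyclic abelian $p$-group of order $p^{m-2}$, $$G'\simeq\mathbb{Z}[X,Y]/\mathfrak{A}\simeq A(p,m-2)$$ (isomorphisms of groups, the middle term being the additive group of the residue class ring), independently of whether $k=0$ or $k\ge1$.
   Context: Nearly homocyclic groups: for a prime $p$ and integer $\mu\ge1$ write $\mu=q(p-1)+r$ with $q\ge0$, $0\le r<p-1$. Then $A(p,\mu)$ is the abelian $p$-group of order $p^\mu$ with type invariants $(p^{q+1},\ldots,p^{q+1},p^q,\ldots,p^q)$, with $r$ entries $p^{q+1}$ and $(p-1)-r$ entries $p^q$, if $\mu\ge p-1$, and $(p,\ldots,p)$ with $\mu$ entries if $1\le\mu<p-1$. Also $A(p,0)=1$. Conventions: $[a,b]=a^{-1}b^{-1}ab$, $t^g=g^{-1}tg$. The lower central series is $\gamma_1(G)=G$, $\gamma_j(G)=[\gamma_{j-1}(G),G]$; $G'=\gamma_2(G)$; $m$ is the index of nilpotency ($\gamma_m(G)=1\ne\gamma_{m-1}(G)$); coclass $=\log_p|G|-$ class.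 Annihilator: for a finite metabelian group $G=\langle x,y\rangle$ put $s_2=[y,x]$. Conjugation makes the abelian group $G'$ a $\mathbb{Z}[G]$-module, $t^{bg+ch}=(t^g)^b(t^h)^c$ (so $t^{x-1}=[t,x]$, $t^{y-1}=[t,y]$; the actions of $x$ and $y$ on $G'$ commute). The annihilator is the ideal $\mathfrak{A}(G)=\{f\in\mathbb{Z}[X,Y]:s_2^{f(x-1,y-1)}=1\}$. Two-step centralizer: $\chi_2(G)=\{g\in G:[g,u]\in\gamma_4(G)\text{ for all }u\in\gamma_2(G)\}$. Normalized generators $x,y$: $x\in G\setminus\chi_2(G)$ if $m\ge4$, and $y\in\chi_2(G)\setminus\gamma_2(G)$. Put $s_j=[s_{j-1},x]$ for $j\ge 3$. The defect $k$ is defined by $[\chi_2(G),\gamma_2(G)]=\gamma_{m-k}(G)$; possible values are $k=0$ for $3\le m\le4$, $0\le k\le m-4$ for $m\ge5$, and $0\le k\le\min(m-4,p-2)$ for $m\ge p+1$ (Miech). Representative $G_a^m(z,w)$ (Miech), with $a=(a(m-k),\ldots,a(m-1))$ and $a(m-k)>0$ if $k\ge1$: the metabelian $p$-group of maximal class of order $p^m$ whose normalized generators satisfy $x^p=s_{m-1}^w$; $\ y^p\prod_{\ell=2}^p s_\ell^{\binom p\ell}=s_{m-1}^z$; $\ s_{j+1}^p\prod_{\ell=2}^p s_{j+\ell}^{\binom p\ell}=1$ for $1\le j\le m-2$; $\ [s_2,y]=\prod_{\ell=1}^k s_{m-\ell}^{a(m-\ell)}$; $\ s_j\ne1$ for $2\le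 j\le m-1$, $s_j=1$ for $j\ge m$, $\gamma_j(G)=\langle s_j,\gamma_{j+1}(G)\rangle$ with $\gamma_j(G)/\gamma_{j+1}(G)\simeq C_p$ for $2\le j\le m-1$; $\ [s_i,s_j]=1$ for $i,j\ge2$. *)

(* Defs.v *)
From HB Require Import structures.
From mathcomp Require Export all_boot all_order all_algebra.
From mathcomp Require Export all_fingroup all_solvable.
From mathcomp Require Import ssrcomplements.
From mathcomp Require Export mpoly.

Set Implicit Arguments.
Unset Strict Implicit.
Unset Printing Implicit Defensive.

Import GRing.Theory.

Local Open Scope group_scope.

Section MaximalClass.

Variable gT : finGroupType.
Implicit Types (G : {group gT}) (x y : gT).

(* The lower central series gamma_j(G) is ['L_j(G)], indexed so that
   ['L_1(G) = G]; [[~ a, b] = a^-1 * b^-1 * a * b]. *)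

Definition metabelian G := abelian G^`(1).

Definition coclass (p : nat) G := (logn p #|G| - nil_class G)%N.

Definition chi2 G : {set gT} :=
  [set g in G | [forall u in 'L_2(G), [~ g, u] \in 'L_4(G)]].

(* The guard [k < m] makes the truncated difference [m - k] genuine. *)
Definition is_defect (m k : nat) G :=
  (k < m)%N /\ [~: chi2 G, 'L_2(G)] = 'L_(m - k)(G).

(* [sgen x y j] is s_j for j >= 2: s_2 = [y, x], s_j = [s_(j-1), x].
   The values at 0 and 1 are junk and never used. *)
Definition sgen x y (j : nat) : gT :=
  iter (j - 2) (fun t => [~ t, x]) [~ y, x].

(* [representative p m k a z w G x y]: the group G is the representative
   G_a^m(z,w) of defect k, realized on its normalized generators x, y. *)
Record representative (p m k : nat) (a : nat -> nat) (z w : nat)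
    G x y : Prop := Representative {
  repr_order : #|G| = (p ^ m)%N;
  repr_metabelian : metabelian G;
  repr_class : nil_class G = m.-1;
  repr_gen : <<[set x; y]>> = G :> {set gT};
  repr_x : (4 <= m)%N -> x \notin chi2 G;
  repr_y : y \in chi2 G :\: 'L_2(G);
  repr_defect : is_defect m k G;
  repr_powx : x ^+ p = sgen x y m.-1 ^+ w;
  repr_powy :
    y ^+ p * \prod_(2 <= l < p.+1) sgen x y l ^+ 'C(p, l)
      = sgen x y m.-1 ^+ z;
  repr_pows : forall j, (1 <= j <= m - 2)%N ->
    sgen x y j.+1 ^+ p * \prod_(2 <= l < p.+1) sgen x y (j + l) ^+ 'C(p, l)
      = 1;
  repr_comm :
    [~ sgen x y 2, y]
      = \prod_(1 <= l < k.+1) sgen x y (m - l) ^+ a (m - l)%N;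
  repr_neq1 : forall j, (2 <= j <= m - 1)%N -> sgen x y j <> 1;
  repr_eq1 : forall j, (m <= j)%N -> sgen x y j = 1;
  repr_lcn : forall j, (2 <= j <= m - 1)%N ->
    'L_j(G) = <<sgen x y j |: 'L_j.+1(G)>>
    /\ 'L_j(G) / 'L_j.+1(G) \isog [set: 'Z_p];
  repr_abel : forall i j, (2 <= i)%N -> (2 <= j)%N ->
    [~ sgen x y i, sgen x y j] = 1
}.

End MaximalClass.

(* The abelian group with |s| cyclic factors of orders p^(s_i); the exponents
   must be positive, since ['Z_1] is not trivial. *)
Definition abelian_of_type (p : nat) (s : seq nat) : finGroupType :=
  {dffun forall i : 'I_(size s), 'Z_(p ^ nth 0%N s i)}.

Definition nearly_homocyclic_exponents (p mu : nat) : seq nat :=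
  let q := (mu %/ p.-1)%N in
  let r := (mu %% p.-1)%N in
  if (p.-1 <= mu)%N then nseq r q.+1 ++ nseq (p.-1 - r) q else nseq mu 1%N.

Definition nearly_homocyclic (p mu : nat) : finGroupType :=
  abelian_of_type p (nearly_homocyclic_exponents p mu).

Local Open Scope ring_scope.

(* Group isomorphism from the additive group of V onto H. *)
Definition add_isog (V : zmodType) (gT : finGroupType) (H : {set gT}) : Prop :=
  exists f : V -> gT,
    [/\ {morph f : u v / u + v >-> (u * v)%g},
        injective f
      & forall t, t \in H <-> exists u, f u = t].

Section Annihilator.

Import FiniteModule.

Variables (gT : finGroupType) (G : {group gT}) (metG : metabelian G).

(* G' as an additive group with the conjugation action [u ^@ g] of G. *)
Local Notation M := (fmod_of metG).

Implicit Types (u v : M) (g x y : gT).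

(* The action of g - 1; multiplicatively t |-> (t ^ g) * t^-1 = [~ t, g]. *)
Definition act_sub1 g u : M := u ^@ g - u.

Definition act_mnm x y (d : 'X_{1..2}) u : M :=
  iter (d ord0) (act_sub1 x) (iter (d ord_max) (act_sub1 y) u).

(* [act_poly x y u f] is u^(f(x-1,y-1)). *)
Definition act_poly x y u (f : {mpoly int[2]}) : M :=
  \sum_(d <- msupp f) act_mnm x y d u *~ f@_d.

Lemma act_sub1E g t : t \in G^`(1)%g -> g \in G ->
  fmval (act_sub1 g (fmod metG t)) = [~ t, g]%g.
Proof.
move=> tG gG; have nG : g \in 'N(G^`(1))%g.
  by rewrite (subsetP (der_norm 1 G)).
have sE : act_sub1 g (fmod metG t) = - fmod metG t + fmod metG t ^@ g.
  by rewrite /act_sub1 addrC.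
by rewrite sE fmvalA fmvalN fmvalJ // fmodK.
Qed.

Lemma act_sub1B g : {morph act_sub1 g : u v / u - v}.
Proof. by move=> u v; rewrite /act_sub1 actAr actNr !opprD opprK addrACA. Qed.

HB.instance Definition _ g :=
  GRing.isZmodMorphism.Build M M (act_sub1 g) (act_sub1B g).

Lemma act_sub1C x y u : x \in G -> y \in G ->
  act_sub1 x (act_sub1 y u) = act_sub1 y (act_sub1 x u).
Proof.
move=> xG yG; have nG g : g \in G -> g \in 'N(G^`(1))%g.
  by move=> gG; rewrite (subsetP (der_norm 1 G)).
have act_triv c (w : M) : c \in G^`(1)%g -> w ^@ c = w.
  move=> cG; apply: val_inj; rewrite fmvalJ ?(subsetP (normG G^`(1))) //.
  by rewrite conjgE (centsP metG _ (fmodP w) _ cG) mulKg.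
have act_comm : u ^@ x ^@ y = u ^@ y ^@ x.
  have cG : [~ x, y]%g \in G^`(1)%g by rewrite mem_commg.
  rewrite -(actrM (nG x xG) (nG y yG)) (commgC x y).
  have yxG : (y * x)%g \in G by rewrite groupM.
  rewrite (actrM (nG _ yxG)) ?nG ?groupR //.
  by rewrite act_triv // (actrM (nG y yG)) ?nG.
rewrite /act_sub1 !actAr !actNr act_comm !opprB.
by rewrite addrACA [RHS]addrACA; congr (_ + _); rewrite addrC.
Qed.

Lemma act_mnmB x y d : {morph act_mnm x y d : u v / u - v}.
Proof.
move=> u v; rewrite /act_mnm.
have iterB g n (u' v' : M) :
    iter n (act_sub1 g) (u' - v')
      = iter n (act_sub1 g) u' - iter n (act_sub1 g) v'.
  by elim: n => // n IHn; rewrite !iterS IHn act_sub1B.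
by rewrite !iterB.
Qed.

HB.instance Definition _ x y d :=
  GRing.isZmodMorphism.Build M M (act_mnm x y d) (act_mnmB x y d).

Lemma act_mnmD x y d e u : x \in G -> y \in G ->
  act_mnm x y (d + e)%MM u = act_mnm x y d (act_mnm x y e u).
Proof.
move=> xG yG; rewrite /act_mnm !mnmDE !iterD; congr (iter _ _ _).
move: (iter (e ord_max) _ u) => w.
have swap1 n v : act_sub1 x (iter n (act_sub1 y) v)
                   = iter n (act_sub1 y) (act_sub1 x v).
  by elim: n => // n IHn; rewrite !iterS act_sub1C // IHn.
by elim: (e ord0) => // n IHn; rewrite !iterS IHn swap1.
Qed.

Lemma act_polyE x y f u k : (msize f <= k)%N ->
  act_poly x y u f = \sum_(d : 'X_{1..2 < k}) act_mnm x y d u *~ f@_d.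
Proof.
move=> le_fk; rewrite /act_poly.
rewrite (big_mksub ('X_{1..2 < k} : subFinType _)) ?msupp_uniq //=; last first.
  by move=> d /msize_mdeg_lt /leq_trans; apply.
rewrite big_rmcond //= => d /memN_msupp_eq0 ->.
by rewrite mulr0z.
Qed.

Lemma act_polyB x y u : {morph act_poly x y u : f g / f - g}.
Proof.
move=> f g; pose k := maxn (msize (f - g)) (maxn (msize f) (msize g)).
rewrite !(@act_polyE _ _ _ _ k) ?leq_max ?leqnn ?orbT // -sumrB.
by apply: eq_bigr => d _; rewrite mcoeffB mulrzBr.
Qed.

HB.instance Definition _ x y u :=
  GRing.isZmodMorphism.Build {mpoly int[2]} M (act_poly x y u)
    (act_polyB x y u).

Lemma act_polyZX x y c d u : act_poly x y u (c *: 'X_[d]) = act_mnm x y d u *~ c.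
Proof.
have [->|c0] := eqVneq c 0; first by rewrite scale0r /act_poly msupp0 big_nil.
by rewrite /act_poly msuppMCX // big_seq1 mcoeffZ mcoeffX eqxx mulr1.
Qed.

Lemma act_polyM x y (f h : {mpoly int[2]}) u : x \in G -> y \in G ->
  act_poly x y u (f * h) = act_poly x y (act_poly x y u h) f.
Proof.
move=> xG yG; rewrite mpolyME (raddf_sum (act_poly x y u)) /=.
rewrite big_allpairs /= [in RHS]/act_poly; apply: eq_bigr => d _.
rewrite (raddf_sum (act_mnm x y d)) /= mulrz_suml.
apply: eq_bigr => e _.
by rewrite act_polyZX act_mnmD // raddfMz -mulrzA mulrC.
Qed.

(* s_2 = [y, x] in G'. *)
Definition s2 x y : M := fmod metG [~ y, x]%g.

(* The last two arguments, which the value ignores, make this predicate a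
   proper ideal by instance: G = <x,y>, and G is not abelian, so s_2 <> 1. *)
Definition annihilator x y of <<[set x; y]>>%g = G & (1 < nil_class G)%N :
    {pred {mpoly int[2]}} :=
  [pred f | act_poly x y (s2 x y) f == 0].

Lemma annihilator_idealr x y (genG : <<[set x; y]>>%g = G)
    (ncG : (1 < nil_class G)%N) : idealr_closed (annihilator genG ncG).
Proof.
have xG : x \in G by rewrite -genG mem_gen ?set21.
have yG : y \in G by rewrite -genG mem_gen ?set22.
split.
- by rewrite inE (raddf0 (act_poly x y _)).
- apply/negP; rewrite inE /act_poly msupp1 big_seq1 mcoeff1 eqxx.
  rewrite mulr1z /act_mnm !mnm0E /= => /eqP/(congr1 fmval).
  rewrite fmodK ?mem_commg // fmval0 => /eqP/commgP cyx.
  move: (ncG); rewrite ltnNge nil_class1 => /negP; apply.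
  rewrite -genG abelian_gen /abelian subUset !sub1set.
  apply/andP; split; apply/centP=> g; rewrite !inE => /orP[]/eqP-> //.
- move=> a f h; rewrite !inE => /eqP f0 /eqP h0.
  rewrite raddfD /= act_polyM // f0 h0 addr0.
  rewrite /act_poly big1 // => d _.
  by rewrite raddf0 mul0rz.
Qed.

HB.instance Definition _ x y genG ncG :=
  isIdealr.Build {mpoly int[2]} (@annihilator x y genG ncG)
    (annihilator_idealr genG ncG).

End Annihilator.

(* Main.v *)
Require Import Defs.

(** The commutator subgroup is written additively, as the module [V] with
    operator [D = x - 1]; put [n = m - 2] and [t_i = s_(i+2)], so that
    [t_i = D^i s_2] and [t_i = 0] for [i >= n].  The relations of the
    representative say that
      [p t_i + C(p,2) t_(i+1) + ... + C(p,p-1) t_(i+p-2) + t_(i+p-1) = 0],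
    that is, [((1 + D)^p - 1) / D] annihilates [V].  So [V] is a quotient of
    the ring of integers of the [p]-th cyclotomic field, in which [1 + D] is
    a primitive [p]-th root of unity and [p] is [D^(p-1)] times a unit; the
    argument below is this one, carried out on the elements [t_i].

    Read from right to left, the relation expresses [t_(i+p-1)] by earlier
    elements, so the first [min(n, p-1)] of the [t_i] already generate [V]
    ([exists_combination]).  Read from left to right, it pushes [p t_i] at
    least [p-1] steps down the filtration, up to multiples of [p t_j] with
    [j > i]; so [p^e t_i = 0] as soon as [n <= i + e (p-1)]
    ([mulrn_expp_eq0]).  The least such exponents [e] are the exponents of
    [A(p, n)], hence there is a surjective homomorphism from [A(p, n)] onto [V],
    [(c_i) |-> \sum_i c_i t_i].  Both groups have order [p^n], so that it is
    bijective ([combination_bij]).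

    Since each [t_i] is the image of [s_2] under [X^i], the map
    [f |-> s_2^(f(x-1,y-1))] is onto [V] as well, and its kernel is the
    annihilator by definition; this identifies the residue class ring with
    the commutator subgroup. *)

Set Implicit Arguments.
Unset Strict Implicit.
Unset Printing Implicit Defensive.

Import GRing.Theory FiniteModule.

Local Open Scope group_scope.

(** * Type invariants of nearly homocyclic groups *)

Section TypeInvariants.

Local Open Scope nat_scope.

Variable p : nat.
Hypothesis p_pr : prime p.

Lemma expn_prime_gt1 n : 0 < n -> 1 < p ^ n.
Proof. by move=> n_gt0; rewrite -(exp1n n) ltn_exp2r ?prime_gt1. Qed.

Lemma card_abelian_of_type (e : seq nat) :
    (forall i, i < size e -> 0 < nth 0 e i) ->
  #|abelian_of_type p e| = p ^ sumn e.
Proof.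
move=> e_gt0; rewrite [LHS]card_dep_ffun foldrE big_map big_enum /=.
rewrite sumnE (big_nth 0) big_mkord expn_sum.
by apply: eq_bigr => i _; rewrite card_ord Zp_cast ?expn_prime_gt1 ?e_gt0.
Qed.

Variable mu : nat.

Local Notation e := (nearly_homocyclic_exponents p mu).

Let p1_gt0 : 0 < p.-1.
Proof. by rewrite -ltnS prednK ?prime_gt1 ?prime_gt0. Qed.

Lemma size_nearly_homocyclic_exponents : size e = minn mu p.-1.
Proof.
rewrite /nearly_homocyclic_exponents; case: leqP => _; last by rewrite size_nseq.
by rewrite size_cat !size_nseq subnKC // ltnW // ltn_mod.
Qed.

Lemma sumn_nearly_homocyclic_exponents : sumn e = mu.
Proof.
rewrite /nearly_homocyclic_exponents; case: leqP => [le_mu | _]; last first.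
  by rewrite sumn_nseq mul1n.
rewrite sumn_cat !sumn_nseq mulSn -addnA -mulnDr subnKC.
  by rewrite addnC -divn_eq.
by rewrite ltnW // ltn_mod.
Qed.

Lemma nearly_homocyclic_exponents_gt0 i : i < size e -> 0 < nth 0 e i.
Proof.
rewrite size_nearly_homocyclic_exponents leq_min => /andP[lt_i_mu lt_i_p].
rewrite /nearly_homocyclic_exponents; case: (leqP p.-1 mu) => [le_mu | _].
  rewrite nth_cat size_nseq !nth_nseq; case: (ltnP i _) => // le_i.
  by rewrite ltn_sub2r ?divn_gt0 // (leq_ltn_trans le_i).
by rewrite nth_nseq lt_i_mu.
Qed.

(** The exponents reach the bound [mu] that [mulrn_expp_eq0] asks for: the
    first [mu %% (p-1)] positions are those where the quotient of [mu] by
    [p-1] is not sufficient. *)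
Lemma nearly_homocyclic_exponents_bound i :
  i < size e -> mu <= i + nth 0 e i * p.-1.
Proof.
rewrite size_nearly_homocyclic_exponents leq_min => /andP[lt_i_mu lt_i_p].
rewrite /nearly_homocyclic_exponents; case: (leqP p.-1 mu) => [le_mu | lt_mu].
  rewrite nth_cat size_nseq !nth_nseq; case: (ltnP i _) => [lt_i | le_i].
    by rewrite (leq_trans _ (leq_addl _ _)) // ltnW // -ltn_divLR.
  rewrite ltn_sub2r ?(leq_ltn_trans le_i) //.
  by rewrite [leqLHS](divn_eq mu p.-1) addnC leq_add2r.
by rewrite nth_nseq lt_i_mu mul1n (leq_trans (ltnW lt_mu)) ?leq_addl.
Qed.

End TypeInvariants.

(** * Abelian groups with the cyclotomic relations *)

Local Open Scope ring_scope.

Section Combination.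

Variables (V : zmodType) (p : nat) (t : nat -> V) (e : seq nat).

(** The coordinates [c i] are residue classes, lifted to their least
    nonnegative representatives; additivity in [c] therefore asks that the
    [t i] be annihilated by the moduli. *)
Definition combination (c : abelian_of_type p e) : V :=
  \sum_(i < size e) t i *+ c i.

Lemma mulrn_modn (v : V) n k : v *+ n = 0 -> v *+ (k %% n) = v *+ k.
Proof.
move=> vn0; rewrite [in RHS](divn_eq k n) mulrnDr mulnC mulrnA vn0.
by rewrite mul0rn add0r.
Qed.

Hypothesis p_pr : prime p.
Hypothesis e_gt0 : forall i, (i < size e)%N -> (0 < nth 0%N e i)%N.
Hypothesis t_mulrn_eq0 :
  forall i, (i < size e)%N -> t i *+ (p ^ nth 0%N e i) = 0.

Lemma combinationM : {morph combination : c d / (c * d)%g >-> c + d}.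
Proof.
move=> c d; rewrite -big_split; apply: eq_bigr => i _ /=.
rewrite mulg_ffun -mulrnDr; apply: mulrn_modn.
by rewrite Zp_cast ?t_mulrn_eq0 // expn_prime_gt1 ?e_gt0.
Qed.

Lemma combination1 : combination 1%g = 0.
Proof. by apply: (addrI (combination 1%g)); rewrite -combinationM mulg1 addr0. Qed.

Lemma combinationV c : combination c^-1%g = - combination c.
Proof.
by apply: (addrI (combination c)); rewrite -combinationM mulgV combination1 subrr.
Qed.

Lemma combinationX c n : combination (c ^+ n)%g = combination c *+ n.
Proof.
by elim: n => [|n IHn]; rewrite ?combination1 // expgS combinationM IHn mulrS.
Qed.

Lemma combination_unit i : (i < size e)%N -> exists c, combination c = t i.
Proof.
move=> lt_i; pose i0 := Ordinal lt_i.
exists (@dfung1 _ (fun j : 'I_(size e) => 'Z_(p ^ nth 0%N e j)) i0 Zp1).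
rewrite /combination (bigD1 i0) //= dfung1_id big1 ?addr0 // => j.
by rewrite eq_sym => ne_j; rewrite dfung1_dflt.
Qed.

End Combination.

Section CyclotomicRelations.

Variables (V : zmodType) (p mu : nat) (t : nat -> V).
Hypothesis p_pr : prime p.
Hypothesis t_eq0 : forall i, (mu <= i)%N -> t i = 0.
Hypothesis t_rel : forall i, \sum_(l < p) t (i + l) *+ 'C(p, l.+1) = 0.

Local Notation e := (nearly_homocyclic_exponents p mu).

Lemma mulrn_prime_shift i :
  t i *+ p = - \sum_(l < p.-1) t (i + l.+1) *+ 'C(p, l.+2).
Proof.
case: p p_pr t_rel => // q _ /(_ i); rewrite big_ord_recl addn0 bin1.
by move/eqP; rewrite addr_eq0 => /eqP.
Qed.

Lemma shift_combination i :
  t (i + p.-1) = - \sum_(l < p.-1) t (i + l) *+ 'C(p, l.+1).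
Proof.
case: p p_pr t_rel => // q _ /(_ i); rewrite big_ord_recr /= binn mulr1n.
by rewrite addrC => /eqP; rewrite addr_eq0 => /eqP.
Qed.

(** Multiplication by [p] moves [t i] down by [p-1] steps: in [p t_i], the
    last term of the relation is [t_(i+p-1)] itself, and all other
    coefficients are divisible by [p], so that these terms are dealt with by
    descending induction on [i]. *)
Lemma mulrn_expp_eq0 n i : (mu <= i + n * p.-1)%N -> t i *+ (p ^ n) = 0.
Proof.
elim: n i => [|n IHn] i; first by rewrite addn0 mulr1n; apply: t_eq0.
have [d] := ubnP (mu - i); elim: d i => // d IHd i lt_d le_mu.
have [/t_eq0-> | lt_i] := leqP mu i; first by rewrite mul0rn.
rewrite expnS mulrnA mulrn_prime_shift mulNrn -sumrMnl big1 ?oppr0 // => l _.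
have le_l : (l.+2 <= p)%N.
  by have := ltn_ord l; rewrite -ltnS prednK ?prime_gt0.
move: le_l; rewrite leq_eqVlt => /predU1P[eq_l | lt_l].
  have -> : 'C(p, l.+2) = 1%N by rewrite eq_l binn.
  have eq_l1 : (l.+1 = p.-1)%N := congr1 predn eq_l.
  by rewrite mulr1n IHn // eq_l1 -addnA -mulSn.
have /dvdnP[b ->] : (p %| 'C(p, l.+2))%N by apply: prime_dvd_bin.
rewrite -mulrnA -mulnA mulnC mulrnA -expnS IHd ?mul0rn //.
  apply: (@leq_trans (mu - i)); last by rewrite -ltnS.
  by rewrite ltn_sub2l // addnS ltnS leq_addr.
by apply: leq_trans le_mu _; rewrite leq_add2r leq_addr.
Qed.

Lemma nearly_homocyclic_mulrn_eq0 i :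
  (i < size e)%N -> t i *+ (p ^ nth 0%N e i) = 0.
Proof.
by move=> lt_i; apply: mulrn_expp_eq0; apply: nearly_homocyclic_exponents_bound.
Qed.

Let e_gt0 := @nearly_homocyclic_exponents_gt0 p p_pr mu.
Let e_mulrn_eq0 := nearly_homocyclic_mulrn_eq0.

Lemma nearly_homocyclic_combinationM :
  {morph @combination V p t e : c d / (c * d)%g >-> c + d}.
Proof. exact: combinationM. Qed.

(** Past the first [p-1] elements, the relation expresses each [t i] by the
    [p-1] elements before it. *)
Lemma exists_combination i : exists c, @combination V p t e c = t i.
Proof.
have [n] := ubnP i; elim: n i => // n IHn i lt_i_n.
have [/combination_unit// | ] := ltnP i (size e).
rewrite size_nearly_homocyclic_exponents // geq_min => /orP[le_mu | le_p].
  by exists 1%g; rewrite combination1 // t_eq0.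
rewrite -(subnK le_p) shift_combination; set j := (i - p.-1)%N.
apply: (@big_ind _ (fun v => exists c, @combination V p t e c = - v)).
- by exists 1%g; rewrite combination1 // oppr0.
- move=> u v [c Dc] [d Dd]; exists (c * d)%g.
  by rewrite combinationM // Dc Dd opprD.
move=> l _; have [|c Dc] := IHn (j + l)%N.
  apply: (@leq_trans i); last by rewrite -ltnS.
  by rewrite -[leqRHS](subnK le_p) ltn_add2l.
by exists (c ^+ 'C(p, l.+1))^-1%g; rewrite combinationV // combinationX // Dc.
Qed.

End CyclotomicRelations.

(** The homomorphism [combination] is onto because its image contains all the
    [t i]; comparing orders gives injectivity. *)
Lemma combination_bij (V : finZmodType) (p mu : nat) (t : nat -> V) :
    prime p -> #|V| = (p ^ mu)%N ->
    (forall i, (mu <= i)%N -> t i = 0) ->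
    (forall i, \sum_(l < p) t (i + l)%N *+ 'C(p, l.+1) = 0) ->
    (forall K : {pred V}, GRing.nmod_closed K -> (forall i, t i \in K) ->
       forall v, v \in K) ->
  bijective (@combination V p t (nearly_homocyclic_exponents p mu)).
Proof.
move=> p_pr cardV t_eq0 t_rel t_gen; set e := nearly_homocyclic_exponents p mu.
pose psi := @combination V p t e.
have psiM : {morph psi : c d / (c * d)%g >-> c + d}.
  exact: nearly_homocyclic_combinationM.
have e_gt0 := @nearly_homocyclic_exponents_gt0 p p_pr mu.
have psi1 : psi 1%g = 0.
  by apply: combination1 => //; apply: nearly_homocyclic_mulrn_eq0.
have onto v : v \in codom psi.
  apply: t_gen => [|i].
    split=> [|_ _ /codomP[c ->] /codomP[d ->]]; last by rewrite -psiM codom_f.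
    by rewrite -psi1 codom_f.
  by have [c <-] := exists_combination p_pr t_eq0 t_rel i; apply: codom_f.
have card_e : #|abelian_of_type p e| = #|V|.
  by rewrite cardV card_abelian_of_type // sumn_nearly_homocyclic_exponents.
apply: inj_card_bij; last by rewrite card_e.
suff: {in predT &, injective psi} by move=> inj c d; apply: inj.
apply/imset_injP/eqP; rewrite -[RHS]/#|abelian_of_type p e| card_e -cardsT.
congr #|pred_of_set _|; apply/setP=> v; rewrite !inE.
by have /codomP[c ->] := onto v; rewrite imset_f.
Qed.

(** * The commutator subgroup of the representative *)

Section CommutatorSubgroup.

Local Open Scope group_scope.

Variables (gT : finGroupType) (G : {group gT}) (p m k z w : nat).
Variables (a : nat -> nat) (x y : gT).
Hypotheses (p_pr : prime p) (metG : metabelian G).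
Hypotheses (pG : p.-group G) (clG : nil_class G = (m - 1)%N).
Hypotheses (ncG : (2 <= nil_class G)%N).
Hypothesis repG : representative p m k a z w G x y.

Local Notation V := (fmod_of metG).

(** The index is shifted so that it counts the applications of [x - 1]. *)
Definition sgen_fmod (i : nat) : V := fmod metG (sgen x y i.+2).

Let m_ge3 : (2 < m)%N.
Proof. by move: ncG; rewrite clG ltn_subRL. Qed.

Let m2K : (m - 2 + 2 = m)%N.
Proof. by rewrite subnK // ltnW. Qed.

Let xG : x \in G.
Proof. by rewrite -(repr_gen repG) mem_gen ?set21. Qed.

Let yG : y \in G.
Proof. by rewrite -(repr_gen repG) mem_gen ?set22. Qed.

Lemma sgenS i : sgen x y i.+3 = [~ sgen x y i.+2, x].
Proof. by rewrite /sgen !subSS !subn0. Qed.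

Lemma sgen_der1 i : sgen x y i.+2 \in G^`(1).
Proof.
elim: i => [|i IHi]; first by rewrite mem_commg.
by rewrite sgenS mem_commg // (subsetP (der_sub 1 G)).
Qed.

Lemma lcn_eq1 : 'L_m(G) = 1.
Proof.
have mK : m = (m - 1).+1 by rewrite subn1 prednK // (ltn_trans _ m_ge3).
by rewrite [in LHS]mK; apply/(lcn_nil_classP _ (pgroup_nil pG)); rewrite clG.
Qed.

Lemma card_lcn i j : (2 <= j)%N -> (i + j = m)%N -> #|'L_j(G)| = (p ^ i)%N.
Proof.
elim: i j => [|i IHi] j j_gt1 Dm; first by rewrite -[j]add0n Dm lcn_eq1 cards1.
have [|_ isoj] := repr_lcn repG (j := j).
  by rewrite j_gt1 -Dm addSn subn1 leq_addl.
have nLj : 'L_j(G) \subset 'N('L_j.+1(G)).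
  exact: subset_trans (lcn_sub j G) (lcn_norm j.+1 G).
have := Lagrange (lcn_subS j G); rewrite -[#|_ : _|](card_quotient nLj).
rewrite (card_isog isoj) cardsT card_ord Zp_cast ?prime_gt1 // => <-.
by rewrite expnSr (IHi j.+1) ?(leqW j_gt1) // addnS -addSn.
Qed.

Lemma lcn_sub_sgen (K : {group gT}) i j :
    (forall l, sgen x y l.+2 \in K) -> (2 <= j)%N -> (i + j = m)%N ->
  'L_j(G) \subset K.
Proof.
move=> sK; elim: i j => [|i IHi] j j_gt1 Dm.
  by rewrite -[j]add0n Dm lcn_eq1 sub1G.
have [|-> _] := repr_lcn repG (j := j).
  by rewrite j_gt1 -Dm addSn subn1 leq_addl.
rewrite gen_subG subUset sub1set IHi ?(leqW j_gt1) //; last first.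
  by rewrite addnS -addSn.
by rewrite andbT -(subnK j_gt1) addn2 sK.
Qed.

Lemma card_fmod_der1 : #|{: V}| = (p ^ (m - 2))%N.
Proof. by rewrite card_sub -(card_lcn _ m2K) // lcn2. Qed.

Lemma sgen_fmod_eq0 i : (m - 2 <= i)%N -> sgen_fmod i = 0%R.
Proof.
by move=> le_i; rewrite /sgen_fmod (repr_eq1 repG) ?fmod1 // -m2K addn2.
Qed.

(** The power relations of the representative concern the nontrivial
    generators; further on, all summands vanish. *)
Lemma sgen_fmod_rel i :
  (\sum_(l < p) sgen_fmod (i + l)%N *+ 'C(p, l.+1) = 0)%R.
Proof.
have [le_i | lt_i] := leqP (m - 2) i.
  rewrite big1 // => l _.
  by rewrite sgen_fmod_eq0 ?mul0rn // (leq_trans le_i) ?leq_addr.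
have := repr_pows repG (j := i.+1) lt_i.
rewrite -(big_mkord xpredT (fun l => sgen_fmod (i + l) *+ 'C(p, l.+1)))%R.
rewrite big_ltn ?prime_gt0 // addn0 bin1 big_add1 /=.
have fmodE l : val (sgen_fmod l) = sgen x y l.+2 by rewrite fmodK ?sgen_der1.
move=> rel; apply: val_inj; rewrite -[RHS]rel fmvalA fmvalZ fmodE.
congr (_ * _); rewrite [LHS]fmval_sum [RHS]big_add1 [RHS]big_add1 /=.
by apply: eq_big_nat => l _; rewrite [LHS]fmvalZ fmodE addSn !addnS.
Qed.

Lemma sgen_fmod_gen (K : {pred V}) :
    GRing.nmod_closed K -> (forall i, sgen_fmod i \in K) -> forall v, v \in K.
Proof.
case=> K0 KD sK v.
have gK : group_set [set u in G^`(1) | fmod metG u \in K].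
  apply/group_setP; split=> [|u u']; first by rewrite inE group1 fmod1.
  rewrite !inE => /andP[Gu Ku] /andP[Gu' Ku'].
  by rewrite groupM // fmodM // KD.
have := @lcn_sub_sgen (Group gK) _ 2 _ (leqnn 2) m2K.
rewrite lcn2 => sGK.
have: fmval v \in [set u in G^`(1) | fmod metG u \in K].
  apply: (subsetP (sGK _)) => [l|]; first by rewrite inE sgen_der1 sK.
  exact: fmodP.
by rewrite inE fmvalK => /andP[].
Qed.

Lemma sgen_fmod_combination (e := nearly_homocyclic_exponents p (m - 2)) :
  {morph @combination V p sgen_fmod e : c d / c * d >-> (c + d)%R}
    /\ bijective (@combination V p sgen_fmod e).
Proof.
split; first exact: nearly_homocyclic_combinationM sgen_fmod_eq0 sgen_fmod_rel.
exact: combination_bij card_fmod_der1 sgen_fmod_eq0 sgen_fmod_rel sgen_fmod_gen.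
Qed.

Lemma act_mnm_sgen i :
  act_mnm x y (U_(ord0) *+ i)%MM (s2 metG x y) = sgen_fmod i.
Proof.
rewrite /act_mnm !mulmnE !mnm1E eqxx mul1n /=.
elim: i => //= i ->; apply: val_inj.
by rewrite [LHS]act_sub1E ?sgen_der1 // [RHS]fmodK ?sgen_der1 // sgenS.
Qed.

(** Polynomials in the first variable alone reach every element, since the
    powers of [x - 1] send [s_2] to the generators. *)
Lemma act_poly_onto v : exists f, act_poly x y (s2 metG x y) f = v.
Proof.
have [_ [psi' _ psi'K]] := sgen_fmod_combination.
rewrite -[v]psi'K; move: (psi' v) => c.
exists (\sum_(i < size (nearly_homocyclic_exponents p (m - 2)))
  'X_[U_(ord0) *+ i] *+ c i)%R.
rewrite raddf_sum; apply: eq_bigr => i _ /=; rewrite raddfMn /=.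
by rewrite -act_mnm_sgen -['X_[_]]scale1r act_polyZX mulr1z.
Qed.

End CommutatorSubgroup.

(** * The residue class ring of the annihilator *)

Section ResidueClassRing.

Variables (gT : finGroupType) (G : {group gT}) (metG : metabelian G).
Variables (x y : gT) (genG : <<[set x; y]>>%g = G).
Hypothesis ncG : (2 <= nil_class G)%N.

Local Notation Q := {ideal_quot (annihilator metG genG ncG)}.

(** The first isomorphism theorem for [f |-> s_2^(f(x-1,y-1))], whose kernel is
    the annihilator. *)
Lemma annihilator_quot_embedding :
  exists phi : Q -> fmod_of metG,
    [/\ {morph phi : q r / q + r}, injective phi
      & forall f, phi (\pi_Q f)%qT = act_poly x y (s2 metG x y) f].
Proof.
pose act := act_poly x y (s2 metG x y).
have eq_pi f g : (\pi_Q f == \pi_Q g)%qT = (act f == act g).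
  by rewrite -[LHS]Quotient.idealrBE inE [act_poly _ _ _ _](raddfB act) subr_eq0.
have piK (q : Q) : (\pi_Q (generic_quotient.repr q))%qT = q by rewrite reprK.
exists (fun q => act (generic_quotient.repr q)); split=> [q r|q r /eqP|f].
- rewrite -(raddfD act); apply/eqP; rewrite -eq_pi piK.
  by rewrite Quotient.pi_add !piK.
- by rewrite -eq_pi !piK => /eqP.
by apply/eqP; rewrite -eq_pi piK.
Qed.

End ResidueClassRing.

Unset Implicit Arguments.

Local Open Scope group_scope.

Theorem theorem6p1 (gT : finGroupType) (G : {group gT})
    (p m k z w : nat) (a : nat -> nat) (x y : gT)
    (p_prime : prime p)
    (pG : p.-group G)
    (metG : metabelian G)
    (cocG : coclass p G = 1%N)
    (ordG : #|G| = (p ^ m)%N)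
    (clG : nil_class G = (m - 1)%N)
    (ncG : (2 <= nil_class G)%N)
    (range_z : (z <= p - 1)%N)
    (range_w : (w <= p - 1)%N)
    (range_a : forall l, (1 <= l <= k)%N -> (a (m - l) <= p - 1)%N)
    (a_pos : (1 <= k)%N -> (0 < a (m - k))%N)
    (repG : representative p m k a z w G x y) :
  let Q := {ideal_quot (annihilator metG (repr_gen repG) ncG)} in
  [/\ add_isog Q G^`(1),
      add_isog Q [set: nearly_homocyclic p (m - 2)]
    & G^`(1) \isog [set: nearly_homocyclic p (m - 2)] ].
Proof.
move=> Q.
have [phi [phiD phi_inj phi_pi]] :=
  annihilator_quot_embedding metG (repr_gen repG) ncG.
have phi_onto v : exists q : Q, phi q = v.
  have [f Df] := act_poly_onto p_prime pG clG ncG repG v.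
  by exists (\pi_Q f)%qT; rewrite phi_pi.
pose psi : nearly_homocyclic p (m - 2) -> fmod_of metG :=
  @combination _ p (sgen_fmod x y metG) (nearly_homocyclic_exponents p (m - 2)).
have [psiM [psi' psiK psi'K]] : {morph psi : c d / c * d >-> (c + d)%R}
    /\ bijective psi := sgen_fmod_combination p_prime metG pG clG ncG repG.
split.
- exists (fun q => fmval (phi q)); split=> [q r|q r /fmod_inj/phi_inj //|t].
    by rewrite phiD.
  split=> [Gt|[q <-]]; last exact: fmodP.
  by have [q Dq] := phi_onto (fmod metG t); exists q; rewrite Dq; apply: fmodK.
- exists (fun q => psi' (phi q)); split=> [q r|q r|c].
  - by apply: (can_inj psiK); rewrite psiM !psi'K phiD.
  - by move/(can_inj psi'K)/phi_inj.
  split=> // _; have [q Dq] := phi_onto (psi c).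
  by exists q; rewrite Dq psiK.
rewrite isog_sym.
have valM : {in [set: nearly_homocyclic p (m - 2)] &,
    {morph (fun c => fmval (psi c)) : c d / c * d}}.
  by move=> c d _ _ /=; rewrite psiM.
apply/isogP; exists (Morphism valM).
  by apply/injmP=> c d _ _ /= /fmod_inj/(can_inj psiK).
apply/setP=> t; apply/morphimP/idP => [[c _ _ ->]|Gt]; first exact: fmodP.
by exists (psi' (fmod metG t)); rewrite ?inE //= psi'K [RHS]fmodK.
Qed.
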